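(* Let $\Pi_{DL}$ be a Datalog program with an admissible instance of its base relations, let $\Pi_{CLP}=\mathit{DL\_to\_CLP}(\Pi_{DL})$ be its CLP translation, and let $\phi$ be a goal (an atom of a derived relation) that is deterministic for $\Pi_{CLP}$. If $solve(\phi,\Pi_{CLP})=\sigma$ and $solve(\phi,\Pi_{DL})=\theta$ for substitutions $\sigma,\theta$, then there exists a substitution $\eta$ such that $\theta=\eta\circ\sigma$ (apply $\sigma$ first, then $\eta$; equality of substitutions on the variables of $\phi$).
   Context: Datalog programs. A program is a finite, non-recursive, well-typed collection of rules ''atom'' (a fact) or ''atom :- $goal_1,\dots,goal_n$''. Atoms have variables or constants as arguments (no function symbols). Predicates are either base relations (representing database tables, whose extension is a finite database instance and which are not heads of rules) or derived relations (defined by the rules). Each argument of each relation has a declared type (string, integer or float), which annotates the variables of the rules. Goals are: an atom; $\mathrm{not}$ atom; $\mathrm{distinct}$(atom) (duplicate elimination); $\mathrm{top}(n,\text{atom})$ (the first $n$ solutions of the atom, i.e. true only for at most $n$ of the true ground instances of the atom, in some fixed selection); a disjunction $goal;\dots;goal$; and a comparison $exp_1\ op\ exp_2$ with $op\in\{>,<,=,<>,\ge,\le\}$ and expressions built from constants, variables, and $+,-,*,/$. A comma denotes conjunction. Base relations. Each base relation $rel$ may have user-defined (CHECK) constraints: Boolean combinations of comparisons between expressions over its columns and constants. A database instance is admissible if each stored tuple is well-typed and satisfies all constraints of its table. Meaning. For an admissible instance, $\llbracket\Pi_{DL}\rrbracket$ is the set of ground facts inferred for each derived relation by $\Pi_{DL}$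 from the instance, with not interpreted as (stratified) negation. A CLP program is a set of rules whose bodies consist of atoms of derived relations, $\mathrm{true}$, and typed constraints $\mathrm{ctr}(\cdot,type)$, combined by conjunction and disjunction. Its meaning $\llbracket\Pi_{CLP}\rrbracket$ is built from all the (possibly non-ground) facts inferred for each relation: each inferred non-ground fact contributes all ground facts obtained by assigning type-compatible values to its variables that satisfy its answer constraints. Comparisons and arithmetic have the same interpretation over values in both settings. The CLP program, and hence its meaning, does not depend on the database instance. Translation. $\mathit{DL\_to\_CLP}$, applied to every rule, sends $head$ :- $goal_1,\dots,goal_n$ to $head$ :- $goal_1',\dots,goal_n'$, where $goal_i'=\mathit{DLGOAL\_to\_CLP}(goal_i)$ (facts are unchanged), and $\mathit{DLGOAL\_to\_CLP}$ is given by: - an atom of a base relation $rel$ $\mapsto$ the conjunction of the user-defined constraints of $rel$, instantiated at the arguments of the atom and annotated with types ($\mathrm{true}$ if there are none); - an atom of a derived relation $\mapsto$ itself; - $(goal_1,goal_2)\mapsto(goal_1',goal_2')$, and likewise disjunctions componentwise; - $\mathrm{top}(n,goal)\mapsto goal'$ and $\mathrm{distinct}(goal)\mapsto goal'$; - $\mathrm{not}(goal)\mapsto\mathrm{true}$; - $exp_1\ op\ exp_2\mapsto\mathrm{ctr}(exp_1\ op\ exp_2,type)$, where $type$ is the type of the expression. Solving. $solve(\phi,\Pi)$ solves the goal $\phi$ in the context of the program $\Pi$ and returns either a success substitution or failure $\bot$. For Datalog (with respect to the given admissible instance), $solve(\phi,\Pi_{DL})=\theta$ means that $\theta$ is a ground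 substitution on the variables of $\phi$ with $\phi\theta\in\llbracket\Pi_{DL}\rrbracket$. For CLP, solving $\phi$ yields answers consisting of a substitution together with a residual answer constraint; the goal $\phi$ is deterministic if there is a single such answer $(\sigma,C)$, and then $solve(\phi,\Pi_{CLP})=\sigma$, where the ground instances of $\phi$ in $\llbracket\Pi_{CLP}\rrbracket$ are exactly the facts $\phi\sigma\gamma$ with $\gamma$ a type-compatible ground substitution satisfying $C$. *)

(* Defs.v *)
From HB Require Import structures.
From mathcomp Require Import all_boot.
From Stdlib Require List Relation_Operators.

Set Implicit Arguments.
Unset Strict Implicit.
Unset Printing Implicit Defensive.

(** * Types, values, variables *)

Inductive ty := TString | TInt | TFloat.

Definition ty_eqb (s t : ty) : bool :=
  match s, t with
  | TString, TString | TInt, TInt | TFloat, TFloat => true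
  | _, _ => false
  end.

Lemma ty_eqbP : Equality.axiom ty_eqb.
Proof. by case; case; constructor. Qed.

HB.instance Definition _ := hasDecEq.Build ty ty_eqbP.

Inductive aop := Add | Sub | Mul | Div.
Inductive cop := Gt | Lt | Eq | Ne | Ge | Le.

(** The (nonempty) sets of strings, integers and floats, with the operations on
    them.  [arith] is partial because of division by zero and the like; nothing
    is assumed about [arith] and [compare], which are shared by the two
    languages. *)
Record domain := Domain {
  carrier : ty -> Type;
  inhabitant : forall t, carrier t;
  arith : aop -> {t : ty & carrier t} -> {t : ty & carrier t} ->
          option {t : ty & carrier t};
  compare : cop -> {t : ty & carrier t} -> {t : ty & carrier t} -> bool
}.

Definition value (D : domain) : Type := {t : ty & carrier D t}.

Definition vtype (D : domain) (v : value D) : ty := tag v.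

(** A variable is a name annotated with its type. *)
Definition var : Type := (nat * ty)%type.

Definition var_ty (x : var) : ty := x.2.

Definition rel : Type := nat.

(** * Expressions and comparisons *)

(** The leaves [X] are the variables of a rule, or the columns (numbered
    from 0) of a table in its CHECK constraints. *)
Inductive exp (D : domain) (X : Type) : Type :=
| ELeaf of X
| ECst of value D
| EBin of aop & exp D X & exp D X.

Arguments ELeaf {D X}.
Arguments ECst {D X}.
Arguments EBin {D X}.

Inductive cmp (D : domain) (X : Type) : Type := Cmp of cop & exp D X & exp D X.

Arguments Cmp {D X}.

Inductive bform (A : Type) : Type :=
| BAtom of A
| BNot of bform A
| BAnd of bform A & bform A
| BOr of bform A & bform A.

Fixpoint bmap (A B : Type) (f : A -> B) (b : bform A) : bform B :=
  match b with
  | BAtom a => BAtom (f a)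
  | BNot b1 => BNot (bmap f b1)
  | BAnd b1 b2 => BAnd (bmap f b1) (bmap f b2)
  | BOr b1 b2 => BOr (bmap f b1) (bmap f b2)
  end.

Fixpoint bsat (A : Type) (p : A -> bool) (b : bform A) : bool :=
  match b with
  | BAtom a => p a
  | BNot b1 => ~~ bsat p b1
  | BAnd b1 b2 => bsat p b1 && bsat p b2
  | BOr b1 b2 => bsat p b1 || bsat p b2
  end.

Fixpoint ball (A : Type) (p : A -> bool) (b : bform A) : bool :=
  match b with
  | BAtom a => p a
  | BNot b1 => ball p b1
  | BAnd b1 b2 | BOr b1 b2 => ball p b1 && ball p b2
  end.

Fixpoint exp_bind (D : domain) (X Y : Type) (f : X -> exp D Y) (e : exp D X) :
    exp D Y :=
  match e with
  | ELeaf x => f x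
  | ECst v => ECst v
  | EBin o e1 e2 => EBin o (exp_bind f e1) (exp_bind f e2)
  end.

Definition cmp_bind (D : domain) (X Y : Type) (f : X -> exp D Y)
    (c : cmp D X) : cmp D Y :=
  let: Cmp o e1 e2 := c in Cmp o (exp_bind f e1) (exp_bind f e2).

Fixpoint eval (D : domain) (X : Type) (env : X -> value D) (e : exp D X) :
    option (value D) :=
  match e with
  | ELeaf x => Some (env x)
  | ECst v => Some v
  | EBin o e1 e2 =>
      if eval env e1 is Some v1 then
        if eval env e2 is Some v2 then arith o v1 v2 else None
      else None
  end.

(** A comparison one of whose sides is undefined is false. *)
Definition cmp_sat (D : domain) (X : Type) (env : X -> value D) (c : cmp D X) :
    bool :=
  let: Cmp o e1 e2 := c in
  if eval env e1 is Some v1 then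
    if eval env e2 is Some v2 then compare o v1 v2 else false
  else false.

(** Arithmetic is numeric; mixing integers and floats gives floats. *)
Definition arith_ty (s t : ty) : option ty :=
  match s, t with
  | TString, _ | _, TString => None
  | TInt, TInt => Some TInt
  | _, _ => Some TFloat
  end.

Definition compare_ty (s t : ty) : option ty :=
  match s, t with
  | TString, TString => Some TString
  | _, _ => arith_ty s t
  end.

(** The type of an expression, [None] if it is ill typed. *)
Fixpoint exp_ty (D : domain) (X : Type) (lty : X -> option ty) (e : exp D X) :
    option ty :=
  match e with
  | ELeaf x => lty x
  | ECst v => Some (vtype v)
  | EBin _ e1 e2 =>
      if exp_ty lty e1 is Some t1 then
        if exp_ty lty e2 is Some t2 then arith_ty t1 t2 else None
      else None
  end.

Definition cmp_ty (D : domain) (X : Type) (lty : X -> option ty) (c : cmp D X) :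
    option ty :=
  let: Cmp _ e1 e2 := c in
  if exp_ty lty e1 is Some t1 then
    if exp_ty lty e2 is Some t2 then compare_ty t1 t2 else None
  else None.

Definition cmp_wt (D : domain) (X : Type) (lty : X -> option ty) (c : cmp D X) :
    bool := isSome (cmp_ty lty c).

(** * Terms, atoms, facts *)

Inductive term (D : domain) : Type := Var of var | Cst of value D.

Arguments Var {D}.
Arguments Cst {D}.

Record atom (D : domain) : Type :=
  Atom { atom_rel : rel; atom_args : seq (term D) }.

Arguments Atom {D}.

Definition fact (D : domain) : Type := (rel * seq (value D))%type.

Definition term_ty (D : domain) (t : term D) : ty :=
  match t with Var x => var_ty x | Cst v => vtype v end.

Definition term_exp (D : domain) (t : term D) : exp D var :=
  match t with Var x => ELeaf x | Cst v => ECst v end.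

Definition atom_vars (D : domain) (a : atom D) : seq var :=
  pmap (fun t => if t is Var x then Some x else None) (atom_args a).

Definition fact_atom (D : domain) (f : fact D) : atom D :=
  Atom f.1 (map Cst f.2).

(** A type-compatible assignment of values to the variables.  Total, but only the
    variables that occur in the object it is applied to matter. *)
Definition valuation (D : domain) : Type := forall x : var, carrier D (var_ty x).

Definition var_val (D : domain) (g : valuation D) (x : var) : value D :=
  existT _ (var_ty x) (g x).

Definition term_val (D : domain) (g : valuation D) (t : term D) : value D :=
  match t with Var x => var_val g x | Cst v => v end.

Definition atom_inst (D : domain) (g : valuation D) (a : atom D) : fact D :=
  (atom_rel a, map (term_val g) (atom_args a)).

(** * Substitutions *)

(** Finite association lists; a variable that is not listed is left unchanged. *)
Definition subst (D : domain) : Type := seq (var * term D).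

Fixpoint lookup (D : domain) (s : subst D) (x : var) : term D :=
  if s is (y, t) :: s' then if x == y then t else lookup s' x else Var x.

Definition term_subst (D : domain) (s : subst D) (t : term D) : term D :=
  match t with Var x => lookup s x | Cst v => Cst v end.

Definition atom_subst (D : domain) (s : subst D) (a : atom D) : atom D :=
  Atom (atom_rel a) (map (term_subst s) (atom_args a)).

Definition subst_comp (D : domain) (eta sigma : subst D) (x : var) : term D :=
  term_subst eta (lookup sigma x).

Definition ground_term (D : domain) (t : term D) : bool :=
  if t is Cst _ then true else false.

Definition ground_on (D : domain) (xs : seq var) (s : subst D) : Prop :=
  {in xs, forall x, ground_term (lookup s x)}.

Definition subst_wt (D : domain) (s : subst D) : Prop :=
  forall x, term_ty (lookup s x) = var_ty x.

Definition ground_instance (D : domain) (a : atom D) (f : fact D) : Prop :=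
  exists s : subst D, atom_subst s a = fact_atom f.

(** * Schemas and database instances *)

(** [checks] is only relevant for base relations. *)
Record schema (D : domain) : Type := Schema {
  is_base : rel -> bool;
  columns : rel -> seq ty;
  checks : rel -> seq (bform (cmp D nat))
}.

Definition schema_wt (D : domain) (S : schema D) : Prop :=
  forall r, is_base S r ->
    all (ball (cmp_wt (onth (columns S r)))) (checks S r).

Definition atom_wt (D : domain) (S : schema D) (a : atom D) : bool :=
  map (@term_ty D) (atom_args a) == columns S (atom_rel a).

(** Default for column numbers that are out of range, which do not occur in the
    constraints of a well-typed schema. *)
Definition value0 (D : domain) : value D := existT _ TInt (inhabitant D TInt).

Definition row_sat (D : domain) (vs : seq (value D)) (b : bform (cmp D nat)) :
    bool :=
  bsat (cmp_sat (nth (value0 D) vs)) b.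

Definition database (D : domain) : Type := seq (fact D).

Definition admissible (D : domain) (S : schema D) (db : database D) : Prop :=
  forall f, List.In f db ->
    [/\ is_base S f.1,
        map (@vtype D) f.2 = columns S f.1
      & all (row_sat f.2) (checks S f.1)].

(** * Datalog *)

Inductive goal (D : domain) : Type :=
| GAtom of atom D
| GNot of atom D
| GDistinct of atom D
| GTop of nat & atom D
| GCmp of cmp D var
| GAnd of goal D & goal D
| GOr of goal D & goal D.

Record rule (D : domain) : Type :=
  Rule { rule_head : atom D; rule_body : seq (goal D) }.

Definition program (D : domain) : Type := seq (rule D).

Fixpoint goal_rels (D : domain) (g : goal D) : seq rel :=
  match g with
  | GAtom a | GNot a | GDistinct a | GTop _ a => [:: atom_rel a]
  | GCmp _ => [::]
  | GAnd g1 g2 | GOr g1 g2 => goal_rels g1 ++ goal_rels g2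
  end.

Definition var_lty (x : var) : option ty := Some (var_ty x).

Fixpoint goal_wt (D : domain) (S : schema D) (g : goal D) : bool :=
  match g with
  | GAtom a | GNot a | GDistinct a | GTop _ a => atom_wt S a
  | GCmp c => cmp_wt var_lty c
  | GAnd g1 g2 | GOr g1 g2 => goal_wt S g1 && goal_wt S g2
  end.

Definition rule_wt (D : domain) (S : schema D) (r : rule D) : bool :=
  [&& ~~ is_base S (atom_rel (rule_head r)),
      atom_wt S (rule_head r) & all (goal_wt S) (rule_body r)].

Definition depends_on (D : domain) (P : program D) (p q : rel) : Prop :=
  exists r, [/\ List.In r P, atom_rel (rule_head r) = p
              & q \in flatten (map (@goal_rels D) (rule_body r))].

Definition nonrecursive (D : domain) (P : program D) : Prop :=
  forall p, ~ Relation_Operators.clos_trans rel (depends_on P) p p.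

Definition program_wf (D : domain) (S : schema D) (P : program D) : Prop :=
  [/\ schema_wt S, forall r, List.In r P -> rule_wt S r & nonrecursive P].

(** Which solutions [top(n, a)] keeps, given the set of all of them. *)
Record selection (D : domain) : Type := Selection {
  selected : nat -> atom D -> (fact D -> Prop) -> fact D -> Prop;
  selected_sub : forall n a F f, selected n a F f -> F f;
  selected_atmost : forall n a F,
    exists2 fs : seq (fact D), size fs <= n &
      forall f, selected n a F f -> List.In f fs
}.

Section DatalogMeaning.
Context {D : domain} (S : schema D) (P : program D)
  (db : database D) (sel : selection D).

Definition holds_fact (I : fact D -> Prop) (f : fact D) : Prop :=
  if is_base S f.1 then List.In f db else I f.

(** [distinct] is invisible here, meanings being sets of facts. *)
Fixpoint holds (I : fact D -> Prop) (g : valuation D) (G : goal D) : Prop :=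
  match G with
  | GAtom a | GDistinct a => holds_fact I (atom_inst g a)
  | GNot a => ~ holds_fact I (atom_inst g a)
  | GTop n a =>
      selected sel n a
        (fun f => holds_fact I f /\ exists g' : valuation D, f = atom_inst g' a)
        (atom_inst g a)
  | GCmp c => cmp_sat (var_val g) c
  | GAnd G1 G2 => holds I g G1 /\ holds I g G2
  | GOr G1 G2 => holds I g G1 \/ holds I g G2
  end.

Definition step (I : fact D -> Prop) (f : fact D) : Prop :=
  exists r (g : valuation D),
    [/\ List.In r P, f = atom_inst g (rule_head r)
      & forall G, List.In G (rule_body r) -> holds I g G].

(** In a nonrecursive program a dependency chain visits each defined relation at
    most once, so the extension of a relation is final after as many steps as
    there are defined relations on a longest chain that starts from it.  After
    [size P] steps all of them are, and negation has been evaluated against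
    final extensions: this is the stratified model. *)
Definition dl_meaning : fact D -> Prop := iter (size P) step (fun _ => False).

Definition dl_solve (phi : atom D) (theta : subst D) : Prop :=
  ground_on (atom_vars phi) theta /\
  exists2 f, atom_subst theta phi = fact_atom f & dl_meaning f.

End DatalogMeaning.

(** * CLP *)

(** Boolean combination of type-annotated comparisons.  Values carry their type,
    so that the annotation plays no role in the truth of a constraint. *)
Definition ctr (D : domain) : Type := bform (cmp D var * ty).

Inductive cgoal (D : domain) : Type :=
| CTrue
| CAtom of atom D
| CCtr of ctr D
| CAnd of cgoal D & cgoal D
| COr of cgoal D & cgoal D.

Arguments CTrue {D}.

Record crule (D : domain) : Type :=
  CRule { crule_head : atom D; crule_body : seq (cgoal D) }.

Definition cprogram (D : domain) : Type := seq (crule D).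

Definition ctr_subst (D : domain) (s : subst D) (c : ctr D) : ctr D :=
  bmap (fun ct => (cmp_bind (fun x => term_exp (lookup s x)) ct.1, ct.2)) c.

Fixpoint cgoal_subst (D : domain) (s : subst D) (G : cgoal D) : cgoal D :=
  match G with
  | CTrue => CTrue
  | CAtom a => CAtom (atom_subst s a)
  | CCtr c => CCtr (ctr_subst s c)
  | CAnd G1 G2 => CAnd (cgoal_subst s G1) (cgoal_subst s G2)
  | COr G1 G2 => COr (cgoal_subst s G1) (cgoal_subst s G2)
  end.

(** A conjunction of constraints. *)
Definition store (D : domain) : Type := seq (ctr D).

Definition store_sat (D : domain) (g : valuation D) (C : store D) : Prop :=
  all (bsat (fun ct => cmp_sat (var_val g) ct.1)) C.

(** [infers Q Gs C]: the conjunction [Gs] of possibly non-ground goals is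
    inferred from [Q] with answer constraint [C]. *)
Inductive infers (D : domain) (Q : cprogram D) : seq (cgoal D) -> store D -> Prop :=
| infers_nil : infers Q [::] [::]
| infers_true Gs C : infers Q Gs C -> infers Q (CTrue :: Gs) C
| infers_ctr c Gs C : infers Q Gs C -> infers Q (CCtr c :: Gs) (c :: C)
| infers_and G1 G2 Gs C :
    infers Q (G1 :: G2 :: Gs) C -> infers Q (CAnd G1 G2 :: Gs) C
| infers_orl G1 G2 Gs C : infers Q (G1 :: Gs) C -> infers Q (COr G1 G2 :: Gs) C
| infers_orr G1 G2 Gs C : infers Q (G2 :: Gs) C -> infers Q (COr G1 G2 :: Gs) C
| infers_atom r s Gs C1 C2 :
    List.In r Q -> subst_wt s ->
    infers Q (map (cgoal_subst s) (crule_body r)) C1 -> infers Q Gs C2 ->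
    infers Q (CAtom (atom_subst s (crule_head r)) :: Gs) (C1 ++ C2).

Definition clp_meaning (D : domain) (Q : cprogram D) (f : fact D) : Prop :=
  exists (a : atom D) (C : store D) (g : valuation D),
    [/\ infers Q [:: CAtom a] C, store_sat g C & f = atom_inst g a].

Definition goal_atom (D : domain) (S : schema D) (phi : atom D) : bool :=
  ~~ is_base S (atom_rel phi) && atom_wt S phi.

(** Any constraint solver: it may simplify answers in its own way, e.g. turn an
    equation into a binding, as long as the answers to a goal describe exactly
    its ground instances that are true. *)
Record clp_solver (D : domain) (S : schema D) (Q : cprogram D) : Type :=
  ClpSolver {
    answers : atom D -> seq (subst D * store D);
    answersP : forall phi, goal_atom S phi -> forall f,
      (clp_meaning Q f /\ ground_instance phi f) <->
      exists sigma C (g : valuation D),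
        [/\ List.In (sigma, C) (answers phi), store_sat g C
          & f = atom_inst g (atom_subst sigma phi)]
  }.

Definition deterministic (D : domain) (S : schema D) (Q : cprogram D)
    (slv : clp_solver S Q) (phi : atom D) : Prop :=
  size (answers slv phi) = 1.

Definition clp_solve (D : domain) (S : schema D) (Q : cprogram D)
    (slv : clp_solver S Q) (phi : atom D) (sigma : subst D) : Prop :=
  exists C, answers slv phi = [:: (sigma, C)].

(** * Translation *)

(** The default annotation is never used on a well-typed comparison. *)
Definition annotate (D : domain) (c : cmp D var) : cmp D var * ty :=
  (c, odflt TString (cmp_ty var_lty c)).

Definition check_inst (D : domain) (ts : seq (term D)) (b : bform (cmp D nat)) :
    ctr D :=
  bmap
    (fun c => annotate
       (cmp_bind (fun i => term_exp (nth (Cst (value0 D)) ts i)) c)) b.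

Definition base_to_clp (D : domain) (S : schema D) (a : atom D) : cgoal D :=
  if [seq CCtr (check_inst (atom_args a) b) | b <- checks S (atom_rel a)]
    is G :: Gs then foldl (@CAnd D) G Gs else CTrue.

Definition atom_to_clp (D : domain) (S : schema D) (a : atom D) : cgoal D :=
  if is_base S (atom_rel a) then base_to_clp S a else CAtom a.

Fixpoint goal_to_clp (D : domain) (S : schema D) (G : goal D) : cgoal D :=
  match G with
  | GAtom a | GDistinct a | GTop _ a => atom_to_clp S a
  | GNot _ => CTrue
  | GCmp c => CCtr (BAtom (annotate c))
  | GAnd G1 G2 => CAnd (goal_to_clp S G1) (goal_to_clp S G2)
  | GOr G1 G2 => COr (goal_to_clp S G1) (goal_to_clp S G2)
  end.

Definition dl_to_clp (D : domain) (S : schema D) (P : program D) : cprogram D :=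
  [seq CRule (rule_head r) (map (goal_to_clp S) (rule_body r)) | r <- P].

(* Main.v *)
(** The translation only weakens rule bodies (a base atom becomes its CHECK
    constraints, negation becomes true), so by induction on the Datalog steps
    every Datalog fact is a CLP fact: grounding the rule instance that produces
    it gives a CLP derivation whose constraints are variable-free and true.
    Hence [phi theta] is a CLP-true instance of [phi]; determinism makes it
    [phi sigma gamma] for some assignment [gamma], and [eta] is [gamma] on the
    variables of [phi sigma]. *)
Require Import Defs.
From mathcomp Require Import all_boot.

Set Implicit Arguments.
Unset Strict Implicit.
Unset Printing Implicit Defensive.

(** * Grounding a rule by a valuation *)

Fixpoint exp_vars (D : domain) (e : exp D var) : seq var :=
  match e with
  | ELeaf x => [:: x]
  | ECst _ => [::]
  | EBin _ e1 e2 => exp_vars e1 ++ exp_vars e2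
  end.

Fixpoint goal_vars (D : domain) (G : goal D) : seq var :=
  match G with
  | GAtom a | GNot a | GDistinct a | GTop _ a => atom_vars a
  | GCmp (Cmp _ e1 e2) => exp_vars e1 ++ exp_vars e2
  | GAnd G1 G2 | GOr G1 G2 => goal_vars G1 ++ goal_vars G2
  end.

(** Body-only variables are included, so that grounding over this list leaves no variable in any
    constraint of the body. *)
Definition rule_vars (D : domain) (r : rule D) : seq var :=
  atom_vars (rule_head r) ++ flatten (map (@goal_vars D) (rule_body r)).

Section Grounding.
Context {D : domain}.
Implicit Types (g h : valuation D) (s : subst D) (xs : seq var).

(** Valuations are total whereas substitutions are finite lists, hence the restriction to [xs]. *)
Definition ground_subst g xs : subst D := [seq (x, Cst (var_val g x)) | x <- xs].

Lemma lookup_ground_subst g xs x :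
  lookup (ground_subst g xs) x =
    if x \in xs then Cst (var_val g x) else Var x.
Proof.
elim: xs => //= y xs IH; rewrite inE.
by case: eqP => [->|_] //=.
Qed.

Lemma ground_subst_wt g xs : subst_wt (ground_subst g xs).
Proof. by move=> x; rewrite lookup_ground_subst; case: ifP. Qed.

Lemma ground_atom_subst g xs (a : atom D) : {subset atom_vars a <= xs} ->
  atom_subst (ground_subst g xs) a = fact_atom (atom_inst g a).
Proof.
case: a => p ts; rewrite /atom_subst /fact_atom /atom_vars /= => sub.
congr Atom; elim: ts sub => //= -[x|v] ts IH /= sub.
  rewrite lookup_ground_subst sub ?mem_head // IH // => y ys.
  by apply: sub; rewrite inE ys orbT.
by rewrite IH.
Qed.

(** [F] is an arbitrary map on terms so that it can be a composite of two substitutions. *)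
Lemma eq_subst_on_vars s (F : term D -> term D) (a : atom D) :
  map (term_subst s) (atom_args a) = map F (atom_args a) ->
  {in atom_vars a, forall x, lookup s x = F (Var x)}.
Proof.
case: a => p ts; rewrite /atom_vars /=.
elim: ts => //= -[x|v] ts IH /= [eq_hd eq_tl] y; last exact: IH.
by rewrite inE => /predU1P[->|]; [|apply: IH].
Qed.

Lemma eval_bind (X Y : Type) (f : X -> exp D Y) env env' (e : exp D X) :
  (forall x, eval env (f x) = Some (env' x)) ->
  eval env (exp_bind f e) = eval env' e.
Proof. by move=> ff; elim: e => //= o e1 -> e2 ->. Qed.

Lemma cmp_sat_bind (X Y : Type) (f : X -> exp D Y) env env' (c : cmp D X) :
  (forall x, eval env (f x) = Some (env' x)) ->
  cmp_sat env (cmp_bind f c) = cmp_sat env' c.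
Proof. by case: c => o e1 e2 ff /=; rewrite !(eval_bind _ ff). Qed.

Lemma eval_term_exp h (t : term D) :
  eval (var_val h) (term_exp t) = Some (term_val h t).
Proof. by case: t. Qed.

Lemma eq_in_eval (env env' : var -> value D) e :
  {in exp_vars e, env =1 env'} -> eval env e = eval env' e.
Proof.
elim: e => //= [x|o e1 IH1 e2 IH2] ee; first by rewrite ee ?mem_head.
by rewrite IH1 ?IH2 // => x xe; apply: ee; rewrite mem_cat xe ?orbT.
Qed.

Lemma bsat_bmap (A B : Type) (f : A -> B) (p : B -> bool) b :
  bsat p (bmap f b) = bsat (p \o f) b.
Proof. by elim: b => //= [b ->|b1 -> b2 ->|b1 -> b2 ->]. Qed.

Lemma eq_bsat (A : Type) (p q : A -> bool) : p =1 q -> bsat p =1 bsat q.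
Proof. by move=> pq; elim=> //= [b ->|b1 -> b2 ->|b1 -> b2 ->]. Qed.

(** Grounding has already put the values of [g] in place of the variables, so [h] has nothing left
    to act on. *)
Lemma ground_cmp_sat g h xs o (e1 e2 : exp D var) :
  {subset exp_vars e1 ++ exp_vars e2 <= xs} ->
  cmp_sat (var_val h)
    (cmp_bind (fun x => term_exp (lookup (ground_subst g xs) x)) (Cmp o e1 e2))
  = cmp_sat (var_val g) (Cmp o e1 e2).
Proof.
move=> sub; rewrite (cmp_sat_bind _ (fun x => eval_term_exp h _)) /=.
by rewrite !(@eq_in_eval _ (var_val g)) // => x xe;
  rewrite lookup_ground_subst sub ?mem_cat ?xe ?orbT.
Qed.

Lemma ground_check_sat g h xs (a : atom D) (b : bform (cmp D nat)) :
  {subset atom_vars a <= xs} ->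
  bsat (fun ct => cmp_sat (var_val h) ct.1)
    (ctr_subst (ground_subst g xs) (check_inst (atom_args a) b))
  = row_sat (atom_inst g a).2 b.
Proof.
move=> /(ground_atom_subst g)[eq_args].
rewrite /ctr_subst /check_inst !bsat_bmap; apply: eq_bsat => c /=.
rewrite (cmp_sat_bind _ (fun x => eval_term_exp h _)).
apply: cmp_sat_bind => i; set s := ground_subst g xs in eq_args *.
have -> t : eval (fun x => term_val h (lookup s x)) (term_exp t)
    = Some (term_val h (term_subst s t)) by case: t.
(* The default is a constant, fixed by the substitution, so [nth] commutes with [map] even out of
   range. *)
have -> : term_subst s (nth (Cst (value0 D)) (atom_args a) i)
    = nth (Cst (value0 D)) (map (term_subst s) (atom_args a)) i.
  by elim: (atom_args a) i => [|t ts IH] [|i] /=.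
rewrite eq_args; congr Some.
by elim: [seq term_val g t | t <- atom_args a] i => [|v vs IH] [|i] /=.
Qed.

End Grounding.

(** * Datalog facts are CLP facts *)

Section Soundness.
Context {D : domain} (S : schema D) (P : program D).
Let Q := dl_to_clp S P.

(** Validity of the answer constraint under all valuations, rather than
    satisfiability, is what lets derivations of several goals be combined. *)
Definition derivable (Gs : seq (cgoal D)) : Prop :=
  exists2 C, infers Q Gs C & forall h, store_sat h C.

(** Quantifying over the remaining goals [Gs] matches the rules of [infers], which act on the head
    of a goal list. *)
Definition derivable_fact (f : fact D) : Prop :=
  forall Gs, derivable Gs -> derivable (CAtom (fact_atom f) :: Gs).

Lemma derivable_and G1 G2 Gs :
  derivable (G1 :: G2 :: Gs) -> derivable (CAnd G1 G2 :: Gs).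
Proof. by case=> C inf sat; exists C => //; apply: infers_and. Qed.

Lemma derivable_ctr c Gs :
  (forall h, bsat (fun ct => cmp_sat (var_val h) ct.1) c) ->
  derivable Gs -> derivable (CCtr c :: Gs).
Proof.
move=> sat_c [C inf sat]; exists (c :: C); first exact: infers_ctr.
by move=> h; rewrite /store_sat /= sat_c; apply: sat.
Qed.

(** The conjunction nests to the left, so the induction generalizes the accumulator [G]. *)
Lemma derivable_foldl_and s G Gs Hs :
  derivable (map (cgoal_subst s) (G :: Gs) ++ Hs) ->
  derivable (cgoal_subst s (foldl (@CAnd D) G Gs) :: Hs).
Proof.
by elim: Gs G => //= G1 Gs IH G der; apply: IH; apply: derivable_and.
Qed.

Context (db : database D) (sel : selection D) (hdb : admissible S db).

Lemma derivable_base g xs (a : atom D) Gs :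
  {subset atom_vars a <= xs} -> List.In (atom_inst g a) db ->
  derivable Gs ->
  derivable (cgoal_subst (ground_subst g xs) (base_to_clp S a) :: Gs).
Proof.
move=> sub /hdb[_ _] /= sat der; rewrite /base_to_clp.
set cs := map _ _.
have: derivable (map (cgoal_subst (ground_subst g xs)) cs ++ Gs).
  rewrite /cs; elim: (checks S (atom_rel a)) sat => //= b bs IH /andP[sat_b sat].
  by apply: derivable_ctr (IH sat) => h; rewrite ground_check_sat.
case: cs => [|G cs]; last exact: derivable_foldl_and.
by case=> C inf satC; exists C => //; apply: infers_true.
Qed.

Lemma derivable_atom (I : fact D -> Prop) g xs (a : atom D) Gs :
  (forall f, I f -> derivable_fact f) ->
  {subset atom_vars a <= xs} -> holds_fact S db I (atom_inst g a) ->
  derivable Gs ->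
  derivable (cgoal_subst (ground_subst g xs) (atom_to_clp S a) :: Gs).
Proof.
move=> hI sub; rewrite /holds_fact /atom_to_clp /=.
case: ifP => _; first exact: derivable_base.
by move=> /hI der /der; rewrite /= ground_atom_subst.
Qed.

Lemma derivable_goal (I : fact D -> Prop) g xs G :
  (forall f, I f -> derivable_fact f) ->
  {subset goal_vars G <= xs} -> holds S db sel I g G ->
  forall Gs, derivable Gs ->
  derivable (cgoal_subst (ground_subst g xs) (goal_to_clp S G) :: Gs).
Proof.
move=> hI; elim: G => [a|a|a|n a|[o e1 e2]|G1 IH1 G2 IH2|G1 IH1 G2 IH2] /= sub.
- by move=> ha Gs; apply: derivable_atom ha.
- by move=> _ Gs [C inf sat]; exists C => //; apply: infers_true.
- by move=> ha Gs; apply: derivable_atom ha.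
- by move=> /selected_sub[ha _] Gs; apply: derivable_atom ha.
- move=> sat Gs; apply: derivable_ctr => h.
  by have := ground_cmp_sat g h o sub => /= ->.
- have [sub1 sub2] : {subset goal_vars G1 <= xs} /\ {subset goal_vars G2 <= xs}.
    by split=> x xG; apply: sub; rewrite mem_cat xG ?orbT.
  move=> [h1 h2] Gs der; apply: derivable_and.
  exact: IH1 sub1 h1 _ (IH2 sub2 h2 _ der).
- have [sub1 sub2] : {subset goal_vars G1 <= xs} /\ {subset goal_vars G2 <= xs}.
    by split=> x xG; apply: sub; rewrite mem_cat xG ?orbT.
  case=> [/(IH1 sub1)|/(IH2 sub2)] IH Gs /IH[C inf sat]; exists C => //.
    exact: infers_orl.
  exact: infers_orr.
Qed.

(** Although negation makes [step] non-monotone, derivability passes through it: negated goals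
    become [CTrue], and only positive goals appeal to [I]. *)
Lemma derivable_step (I : fact D -> Prop) f :
  (forall f', I f' -> derivable_fact f') ->
  step S P db sel I f -> derivable_fact f.
Proof.
move=> hI [r [g [rP -> body]]] Gs [C2 inf2 sat2].
set s := ground_subst g (rule_vars r).
have [C1 inf1 sat1] :
    derivable (map (cgoal_subst s) (map (goal_to_clp S) (rule_body r))).
  have : {subset flatten (map (@goal_vars D) (rule_body r)) <= rule_vars r}.
    by move=> x xb; rewrite mem_cat xb orbT.
  elim: (rule_body r) body => [|G Gb IH] /= body sub.
    by exists [::] => //; apply: infers_nil.
  apply: (derivable_goal hI) => [x xG||].
  - by apply: sub; rewrite mem_cat xG.
  - by apply: body; left.
  - apply: IH => [G' inG'|x xGb]; first by apply: body; right.
    by apply: sub; rewrite mem_cat xGb orbT.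
(* The fact is turned back into an instance of the rule head, the form [infers_atom] requires. *)
rewrite -(@ground_atom_subst _ g (rule_vars r)); last first.
  by move=> x xh; rewrite mem_cat xh.
exists (C1 ++ C2); last first.
  by move=> h; rewrite /store_sat all_cat sat1 sat2.
exact: (@infers_atom _ _ (CRule _ _) s _ _ _
  (List.in_map _ _ _ rP) (ground_subst_wt g _) inf1 inf2).
Qed.

Lemma dl_meaning_sub_clp f : dl_meaning S P db sel f -> clp_meaning Q f.
Proof.
move=> dl_f.
have: derivable_fact f.
  rewrite /dl_meaning in dl_f.
  by elim: (size P) f dl_f => //= n IH f; apply: derivable_step.
case/(_ [::]); first by exists [::] => //; apply: infers_nil.
move=> C inf sat.
(* Any valuation would do: the atom is ground and [C] is valid. *)
exists (fact_atom f), C, (fun x => inhabitant D (var_ty x)); split=> //.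
case: f {dl_f inf} => p vs; congr pair; rewrite /= -map_comp.
by rewrite (eq_map (g := id)) ?map_id.
Qed.

End Soundness.

Theorem proposition3 (D : domain) (S : schema D) (P : program D)
    (hP : program_wf S P)
    (db : database D) (hdb : admissible S db) (sel : selection D)
    (slv : clp_solver S (dl_to_clp S P))
    (phi : atom D) (hphi : goal_atom S phi) (hdet : deterministic slv phi)
    (sigma theta : subst D)
    (hsigma : clp_solve slv phi sigma)
    (htheta : dl_solve S P db sel phi theta) :
  exists eta : subst D,
    {in atom_vars phi, lookup theta =1 subst_comp eta sigma}.
Proof.
case: htheta => _ [f theta_f dl_f].
have [] := (answersP slv hphi f).1
  (conj (dl_meaning_sub_clp hdb dl_f) (ex_intro _ theta theta_f)).
(* The list of answers is a singleton, so the answer that yields [f] carries [sigma] itself. *)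
case: hsigma => C0 -> sigma' [C [g [[[<- _]|[]] _ f_g]]].
set a := atom_subst sigma phi in f_g.
exists (ground_subst g (atom_vars a)).
(* Both sides are the ground atom of [f]; comparing their arguments gives the equation at each
   variable of [phi]. *)
have: atom_subst theta phi = atom_subst (ground_subst g (atom_vars a)) a.
  by rewrite theta_f ground_atom_subst // f_g.
by case; rewrite -map_comp => /eq_subst_on_vars.
Qed.
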